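(* Let $\mathbb{K}=\mathbb{R}$ or $\mathbb{C}$, let $(X,B)\in\mathbb{K}^{n\times p}\times\mathbb{K}^{n\times p}$, and let $\mathbb{S}\in\{\mathsf{sym},\mathsf{skew\mbox{-}sym},\mathsf{Herm}\}$. Suppose that $\mathrm{rank}(X)=r$ and consider the singular value decomposition $X=U\Sigma V^H$. Partition $U=[U_1\ U_2]$ and $V=[V_1\ V_2]$, where $U_1\in\mathbb{K}^{n\times r}$ and $V_1\in\mathbb{K}^{p\times r}$. Let $\Sigma_1:=\Sigma(1:r,1:r)=\mathrm{diag}(\sigma_1,\dots,\sigma_r)$. Let $D\in\mathbb{C}^{r\times r}$ be given by $D_{ij}:=\dfrac{1}{\sigma_i^2+\sigma_j^2}$ and let $\circ$ denote the Hadamard (entrywise) product. Then $$\rho^{\mathbb{S}}(X,B)=\begin{cases}\sqrt{\|(D\circ(\Sigma_1U_1^*BV_1+V_1^*B^*U_1\Sigma_1))\Sigma_1-U_1^*BV_1\|_F^2+\|BV_2\|_F^2}, & \text{if } \mathbb{S}\in\{\mathsf{sym},\mathsf{Herm}\},\\[1ex] \sqrt{\|(D\circ(\Sigma_1U_1^TBV_1-V_1^TB^TU_1\Sigma_1))\Sigma_1-U_1^TBV_1\|_F^2+\|BV_2\|_F^2}, & \text{if } \mathbb{S}=\mathsf{skew\mbox{-}sym},\end{cases}$$ where $*=T$ when $\mathbb{S}=\mathsf{sym}$ and $*=H$ when $\mathbb{S}=\mathsf{Herm}$. Further, $A_o\in\mathbb{S}$ and $\|A_oX-B\|_F=\rho^{\mathbb{S}}(X,B)$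 if and only if $A_o$ is of the form $$A_o=\begin{cases}\mathcal{F}_+^T(X,B)+(I-XX^\dagger)^TZ(I-XX^\dagger), & \text{if } \mathbb{S}=\mathsf{sym},\\ \mathcal{F}_-^T(X,B)+(I-XX^\dagger)^TZ(I-XX^\dagger), & \text{if } \mathbb{S}=\mathsf{skew\mbox{-}sym},\\ \mathcal{F}_+^H(X,B)+(I-XX^\dagger)^HZ(I-XX^\dagger), & \text{if } \mathbb{S}=\mathsf{Herm},\end{cases}$$ for some $Z\in\mathbb{S}$, where $$\mathcal{F}_\pm^T(X,B):=\overline{U}_1[D\circ(\Sigma_1U_1^TBV_1\pm V_1^TB^TU_1\Sigma_1)]U_1^H\pm(BX^\dagger)^T(I-XX^\dagger)+(I-XX^\dagger)^TBX^\dagger,$$ $$\mathcal{F}_+^H(X,B):=U_1[D\circ(\Sigma_1U_1^HBV_1+V_1^HB^HU_1\Sigma_1)]U_1^H+(BX^\dagger)^H(I-XX^\dagger)+(I-XX^\dagger)^HBX^\dagger.$$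
   Context: $Y^T$, $Y^H$, $\overline{Y}$ and $Y^\dagger$ denote the transpose, conjugate transpose, complex conjugate and Moore-Penrose pseudo-inverse of a matrix $Y$; $\|\cdot\|_F$ is the Frobenius norm. In the singular value decomposition $X=U\Sigma V^H$, $U$ ($n\times n$) and $V$ ($p\times p$) are unitary and $\sigma_1,\dots,\sigma_r>0$ are the nonzero singular values of $X$. Classes of matrices: $\mathsf{sym}:=\{A\in\mathbb{K}^{n\times n}:A^T=A\}$, $\mathsf{skew\mbox{-}sym}:=\{A\in\mathbb{K}^{n\times n}:A^T=-A\}$, $\mathsf{Herm}:=\{A\in\mathbb{C}^{n\times n}:A^H=A\}$. For such a class $\mathbb{S}$, $\rho^{\mathbb{S}}(X,B):=\inf\{\|AX-B\|_F: A\in\mathbb{S}\}$.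
   Formalization: In ρ and in F±^T, F+^H, the printed Σ₁U₁^*BV₁ ± V₁^*B^*U₁Σ₁ is replaced by U₁^*BV₁Σ₁ ± Σ₁V₁^*B^*U₁ ( * = T or H); the printed order fails, e.g. for sym with X = diag(1,2), U = V = I, B = E₁₂ (it gives ρ² = 2/5, the true value is 1/5). *)

(* Defs.v *)
From HB Require Import structures.
From mathcomp Require Import all_boot all_order all_algebra.
From mathcomp Require Import complex.
From mathcomp Require Import boolp classical_sets reals.

Set Implicit Arguments.
Unset Strict Implicit.
Unset Printing Implicit Defensive.

Import Order.TTheory GRing.Theory Num.Theory.
Import ComplexField.Normc.

Local Open Scope ring_scope.
Local Open Scope complex_scope.
Local Open Scope sesquilinear_scope.

(* Everything lives over C = R[i], with R : realType.  A matrix over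
   \mathbb{K} is a complex matrix all of whose entries lie in \mathbb{K}. *)
Inductive base_field := RealField | ComplexField.

Definition scalars (R : realType) (K : base_field) : {pred R[i]} :=
  match K with RealField => Num.real | ComplexField => predT end.
Arguments scalars R K : clear implicits.

Inductive mx_class := Sym | SkewSym | Herm.

(* Hermitian matrices are complex matrices whatever \mathbb{K} is. *)
Definition in_class (R : realType) (K : base_field) (S : mx_class) (n : nat)
    (A : 'M[R[i]]_n) : Prop :=
  match S with
  | Sym => A \is a mxOver (scalars R K) /\ A^T = A
  | SkewSym => A \is a mxOver (scalars R K) /\ A^T = - A
  | Herm => A^t* = A
  end.

Definition frobenius (R : realType) (m n : nat) (A : 'M[R[i]]_(m, n)) : R :=
  Num.sqrt (\sum_i \sum_j normc (A i j) ^+ 2).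

Definition rho (R : realType) (K : base_field) (S : mx_class) (n p : nat)
    (X B : 'M[R[i]]_(n, p)) : R :=
  inf [set frobenius (A *m X - B) | A in [set A : 'M[R[i]]_n | in_class K S A]].

Definition is_mpinv (R : realType) (m n : nat)
    (Y : 'M[R[i]]_(m, n)) (W : 'M[R[i]]_(n, m)) : Prop :=
  [/\ Y *m W *m Y = Y, W *m Y *m W = W,
      (Y *m W)^t* = Y *m W & (W *m Y)^t* = W *m Y].

(* The Penrose equations have exactly one solution, so xget never falls back
   on its default value 0. *)
Definition mpinv (R : realType) (m n : nat) (Y : 'M[R[i]]_(m, n)) :
  'M[R[i]]_(n, m) := xget 0 [set W | is_mpinv Y W]%classic.

Definition hadamard (R : realType) (m n : nat) (A B : 'M[R[i]]_(m, n)) :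
  'M[R[i]]_(m, n) := map2_mx *%R A B.

Definition first_cols (T : Type) (m n r : nat) (hr : (r <= n)%N)
    (M : 'M[T]_(m, n)) : 'M[T]_(m, r) :=
  colsub (widen_ord hr) M.

Definition last_cols (T : Type) (m n r : nat) (hr : (r <= n)%N)
    (M : 'M[T]_(m, n)) : 'M[T]_(m, n - r) :=
  colsub (fun j : 'I_(n - r) => cast_ord (subnKC hr) (rshift r j)) M.

Definition leading_block (T : Type) (n p r : nat) (hrn : (r <= n)%N)
    (hrp : (r <= p)%N) (M : 'M[T]_(n, p)) : 'M[T]_r :=
  mxsub (widen_ord hrn) (widen_ord hrp) M.

(* X = U Sg V^H over \mathbb{K}, where the nonzero entries of the rectangular
   diagonal matrix Sg are s 0, ..., s (r - 1), in the first r diagonal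
   positions; they need not be sorted. *)
Definition is_svd (R : realType) (K : base_field) (n p r : nat)
    (hrn : (r <= n)%N) (hrp : (r <= p)%N) (X : 'M[R[i]]_(n, p))
    (U : 'M[R[i]]_n) (s : 'I_r -> R) (Sg : 'M[R[i]]_(n, p))
    (V : 'M[R[i]]_p) : Prop :=
  [/\ U \is a mxOver (scalars R K) /\ U \is unitarymx,
      V \is a mxOver (scalars R K) /\ V \is unitarymx,
      forall k, 0 < s k,
      Sg = \sum_(k < r) (s k)%:C *: delta_mx (widen_ord hrn k) (widen_ord hrp k)
    & X = U *m Sg *m V^t*].

Definition Dmx (R : realType) (r : nat) (s : 'I_r -> R) : 'M[R[i]]_r :=
  \matrix_(i, j) (1 / (s i ^+ 2 + s j ^+ 2))%:C.

(* Let M = U1^* B V1 and N = M^*, where * is T or H.  The A11 in the class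
   minimizing |A11 S1 - M|_F solves A11 S1^2 + S1^2 A11 = M S1 +- S1 N, so
   A11 = D o (M S1 +- S1 N).  The source prints D o (S1 M +- N S1), which is not
   the minimizer in general: take S1 = diag(1, 2) and M = delta_mx 0 1. *)

Definition coreT_plus (R : realType) (n p r : nat) (s : 'I_r -> R)
    (U1 : 'M[R[i]]_(n, r)) (S1 : 'M[R[i]]_r) (V1 : 'M[R[i]]_(p, r))
    (B : 'M[R[i]]_(n, p)) : 'M[R[i]]_r :=
  hadamard (Dmx s)
    (U1^T *m B *m V1 *m S1 + S1 *m V1^T *m B^T *m U1).

Definition coreT_minus (R : realType) (n p r : nat) (s : 'I_r -> R)
    (U1 : 'M[R[i]]_(n, r)) (S1 : 'M[R[i]]_r) (V1 : 'M[R[i]]_(p, r))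
    (B : 'M[R[i]]_(n, p)) : 'M[R[i]]_r :=
  hadamard (Dmx s)
    (U1^T *m B *m V1 *m S1 - S1 *m V1^T *m B^T *m U1).

Definition coreH_plus (R : realType) (n p r : nat) (s : 'I_r -> R)
    (U1 : 'M[R[i]]_(n, r)) (S1 : 'M[R[i]]_r) (V1 : 'M[R[i]]_(p, r))
    (B : 'M[R[i]]_(n, p)) : 'M[R[i]]_r :=
  hadamard (Dmx s)
    (U1^t* *m B *m V1 *m S1 + S1 *m V1^t* *m B^t* *m U1).

Definition FT_plus (R : realType) (n p r : nat) (s : 'I_r -> R)
    (U1 : 'M[R[i]]_(n, r)) (S1 : 'M[R[i]]_r) (V1 : 'M[R[i]]_(p, r))
    (X B : 'M[R[i]]_(n, p)) : 'M[R[i]]_n :=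
  let P := 1%:M - X *m mpinv X in
  map_mx Num.conj U1 *m coreT_plus s U1 S1 V1 B *m U1^t*
    + (B *m mpinv X)^T *m P + P^T *m B *m mpinv X.

Definition FT_minus (R : realType) (n p r : nat) (s : 'I_r -> R)
    (U1 : 'M[R[i]]_(n, r)) (S1 : 'M[R[i]]_r) (V1 : 'M[R[i]]_(p, r))
    (X B : 'M[R[i]]_(n, p)) : 'M[R[i]]_n :=
  let P := 1%:M - X *m mpinv X in
  map_mx Num.conj U1 *m coreT_minus s U1 S1 V1 B *m U1^t*
    - (B *m mpinv X)^T *m P + P^T *m B *m mpinv X.

Definition FH_plus (R : realType) (n p r : nat) (s : 'I_r -> R)
    (U1 : 'M[R[i]]_(n, r)) (S1 : 'M[R[i]]_r) (V1 : 'M[R[i]]_(p, r))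
    (X B : 'M[R[i]]_(n, p)) : 'M[R[i]]_n :=
  let P := 1%:M - X *m mpinv X in
  U1 *m coreH_plus s U1 S1 V1 B *m U1^t*
    + (B *m mpinv X)^t* *m P + P^t* *m B *m mpinv X.

(* Main.v *)
(* With X = U1 S1 V1^H and P = I - U1 U1^H, unitary invariance of the Frobenius
   norm splits |A X - B|^2 into |A11 S1 - M|^2, |P^* (A U1 S1 - B V1)|^2 and the
   constant |B V2|^2, where A11 = U1^* A U1 and M = U1^* B V1.  The middle term
   vanishes for a suitable off-diagonal block of A.  The first one is a least
   squares problem over the class, whose normal equation is solved by the
   Hadamard product C with D, and by Pythagoras it equals
   |C S1 - M|^2 + |(A11 - C) S1|^2.  Hence the minimizers are the A whose
   (U1, U1) and (P, U1) blocks are prescribed; only the (P, P) block is free. *)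

Require Import Defs.
From HB Require Import structures.
From mathcomp Require Import all_boot all_order all_algebra.
From mathcomp Require Import complex.
From mathcomp Require Import boolp classical_sets reals.
From mathcomp Require Import ring.

Set Implicit Arguments.
Unset Strict Implicit.
Unset Printing Implicit Defensive.

Import Order.TTheory GRing.Theory Num.Theory.

Local Open Scope ring_scope.
Local Open Scope complex_scope.
Local Open Scope sesquilinear_scope.

(** * Conjugate transposes and the adjoint attached to a class *)

Lemma trmxC_mul (R : realType) m n p (A : 'M[R[i]]_(m, n))
    (B : 'M[R[i]]_(n, p)) : (A *m B)^t* = B^t* *m A^t*.
Proof. by rewrite trmx_mul map_mxM. Qed.

Lemma trmxCK (R : realType) m n (A : 'M[R[i]]_(m, n)) : A^t*^t* = A.
Proof. by apply/matrixP=> i j; rewrite !mxE conjCK. Qed.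

Lemma trmxCD (R : realType) m n (A B : 'M[R[i]]_(m, n)) :
  (A + B)^t* = A^t* + B^t*.
Proof. by rewrite linearD map_mxD. Qed.

Lemma trmxCN (R : realType) m n (A : 'M[R[i]]_(m, n)) : (- A)^t* = - A^t*.
Proof. by rewrite linearN map_mxN. Qed.

(* [sadj S] and [sgn S] treat the three classes at once: the class is
   [sadj S A = sgn S *: A]. *)
Definition sadj (R : realType) (S : mx_class) m n (A : 'M[R[i]]_(m, n)) :
  'M[R[i]]_(n, m) := if S is Herm then A^t* else A^T.

Definition sgn (R : realType) (S : mx_class) : R[i] :=
  if S is SkewSym then -1 else 1.
Arguments sgn R S : clear implicits.

Lemma sadjM (R : realType) S m n p (A : 'M[R[i]]_(m, n))
    (B : 'M[R[i]]_(n, p)) : sadj S (A *m B) = sadj S B *m sadj S A.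
Proof. by case: S => /=; rewrite ?trmxC_mul ?trmx_mul. Qed.

Lemma sadjK (R : realType) S m n (A : 'M[R[i]]_(m, n)) : sadj S (sadj S A) = A.
Proof. by case: S => /=; rewrite ?trmxCK ?trmxK. Qed.

Lemma sadjD (R : realType) S m n (A B : 'M[R[i]]_(m, n)) :
  sadj S (A + B) = sadj S A + sadj S B.
Proof. by case: S => /=; rewrite ?trmxCD ?linearD. Qed.

Lemma sadjN (R : realType) S m n (A : 'M[R[i]]_(m, n)) :
  sadj S (- A) = - sadj S A.
Proof. by case: S => /=; rewrite ?trmxCN ?linearN. Qed.

Lemma sadj1 (R : realType) S n : sadj S (1%:M : 'M[R[i]]_n) = 1%:M.
Proof. by case: S => /=; rewrite ?trmx1 ?map_mx1. Qed.

Lemma sadj0 (R : realType) S m n : sadj S (0 : 'M[R[i]]_(m, n)) = 0.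
Proof. by case: S => /=; rewrite ?trmx0 ?map_mx0. Qed.

(** The sign is real, so it also passes through the conjugate-linear adjoint. *)
Lemma sadj_sgnZ (R : realType) S m n (A : 'M[R[i]]_(m, n)) :
  sadj S (sgn R S *: A) = sgn R S *: sadj S A.
Proof. by case: S => /=; rewrite ?scale1r ?scaleN1r ?linearN. Qed.

Lemma sadjC (R : realType) S m n (A : 'M[R[i]]_(m, n)) :
  sadj S (A^t*) = (sadj S A)^t*.
Proof. by case: S => //=; rewrite map_trmx. Qed.

Lemma sgn_sqr (R : realType) S : sgn R S * sgn R S = 1.
Proof. by case: S; rewrite /= ?mulrNN mulr1. Qed.

(** * Matrices with entries in the scalar field *)

Definition over_field (R : realType) (K : base_field) m n (A : 'M[R[i]]_(m, n)) :=
  K = RealField -> map_mx Num.conj A = A.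

(** Reality becomes invariance under conjugation, which sums, products and adjoints inherit by
    rewriting. *)
Lemma overP (R : realType) K m n (A : 'M[R[i]]_(m, n)) :
  A \is a mxOver (scalars R K) <-> over_field K A.
Proof.
rewrite /over_field; split=> [/mxOverP A_K K_R | A_K]; last first.
  apply/mxOverP=> i j; case: K A_K => //= /(_ erefl)/matrixP/(_ i j).
  by rewrite mxE => /CrealP.
apply/matrixP=> i j; rewrite mxE; have := A_K i j; rewrite K_R /=.
by move/CrealP.
Qed.

Lemma overM (R : realType) K m n p (A : 'M[R[i]]_(m, n))
    (B : 'M[R[i]]_(n, p)) : over_field K A -> over_field K B -> over_field K (A *m B).
Proof. by move=> hA hB hK; rewrite map_mxM hA ?hB. Qed.

Lemma overD (R : realType) K m n (A B : 'M[R[i]]_(m, n)) :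
  over_field K A -> over_field K B -> over_field K (A + B).
Proof. by move=> hA hB hK; rewrite map_mxD hA ?hB. Qed.

Lemma overN (R : realType) K m n (A : 'M[R[i]]_(m, n)) :
  over_field K A -> over_field K (- A).
Proof. by move=> hA hK; rewrite map_mxN hA. Qed.

Lemma over1 (R : realType) K n : over_field K (1%:M : 'M[R[i]]_n).
Proof. by move=> hK; rewrite map_mx1. Qed.

Lemma over_sgnZ (R : realType) K S m n (A : 'M[R[i]]_(m, n)) :
  over_field K A -> over_field K (sgn R S *: A).
Proof.
by case: S => //= hA; rewrite ?scale1r ?scaleN1r //; apply: overN.
Qed.

Lemma over_trmxC (R : realType) K m n (A : 'M[R[i]]_(m, n)) :
  over_field K A -> over_field K (A^t*).
Proof. by move=> hA hK; rewrite -map_trmx hA -?map_trmx ?hA. Qed.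

Lemma over_sadj (R : realType) K S m n (A : 'M[R[i]]_(m, n)) :
  over_field K A -> over_field K (sadj S A).
Proof.
by case: S => /= hA; last exact: over_trmxC; move=> hK; rewrite -map_trmx hA.
Qed.

(* The class of Hermitian matrices carries no reality condition. *)
Definition class_field (S : mx_class) (K : base_field) :=
  if S is Herm then ComplexField else K.

Lemma over_class_field (R : realType) K S m n (A : 'M[R[i]]_(m, n)) :
  over_field K A -> over_field (class_field S K) A.
Proof. by case: S. Qed.

Lemma in_classP (R : realType) K S n (A : 'M[R[i]]_n) :
  in_class K S A <-> over_field (class_field S K) A /\ sadj S A = sgn R S *: A.
Proof.
have hK := overP K A; case: S => /=; rewrite ?scale1r ?scaleN1r.
- by split=> -[/hK hA1 hA2]; split.
- by split=> -[/hK hA1 hA2]; split.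
- by split=> [hA|[]//]; split.
Qed.

(** * The squared Frobenius norm, its splittings and orthogonality *)

Definition sqnorm (R : realType) m n (A : 'M[R[i]]_(m, n)) : R :=
  \sum_i \sum_j Normc.normc (A i j) ^+ 2.

Lemma sqnorm_ge0 (R : realType) m n (A : 'M[R[i]]_(m, n)) : 0 <= sqnorm A.
Proof. by apply: sumr_ge0 => i _; apply: sumr_ge0 => j _; rewrite sqr_ge0. Qed.

Lemma frobeniusE (R : realType) m n (A : 'M[R[i]]_(m, n)) :
  frobenius A = Num.sqrt (sqnorm A).
Proof. by []. Qed.

Lemma sqr_frobenius (R : realType) m n (A : 'M[R[i]]_(m, n)) :
  frobenius A ^+ 2 = sqnorm A.
Proof. by rewrite frobeniusE sqr_sqrtr ?sqnorm_ge0. Qed.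

Lemma sqnorm_eq0 (R : realType) m n (A : 'M[R[i]]_(m, n)) :
  sqnorm A = 0 -> A = 0.
Proof.
have sq0 i j : 0 <= Normc.normc (A i j) ^+ 2 by rewrite sqr_ge0.
move/psumr_eq0P => A0; apply/matrixP=> i j; rewrite mxE; apply: Normc.eq0_normc.
have /psumr_eq0P/(_ j isT)/eqP : \sum_j Normc.normc (A i j) ^+ 2 = 0.
  by apply: A0 => // k _; apply: sumr_ge0.
by rewrite sqrf_eq0 => /(_ (fun _ _ => sq0 _ _))/eqP.
Qed.

Lemma sqnormE (R : realType) m n (A : 'M[R[i]]_(m, n)) :
  (sqnorm A)%:C = \tr (A *m A^t*).
Proof.
rewrite rmorph_sum; apply: eq_bigr => i _; rewrite mxE rmorph_sum.
apply: eq_bigr => j _; rewrite !mxE -normCK rmorphXn; congr (_ ^+ 2).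
Qed.

Lemma sqnorm_trmxC (R : realType) m n (A : 'M[R[i]]_(m, n)) :
  sqnorm (A^t*) = sqnorm A.
Proof. by apply: complexI; rewrite !sqnormE trmxCK mxtrace_mulC. Qed.

Lemma sqnormN (R : realType) m n (A : 'M[R[i]]_(m, n)) :
  sqnorm (- A) = sqnorm A.
Proof. by apply: complexI; rewrite !sqnormE trmxCN mulmxN mulNmx opprK. Qed.

(** [L] stacked on [N] is an isometry; the computation is cyclicity of the trace. *)
Lemma sqnorm_split_row (R : realType) m n k l (L : 'M[R[i]]_(k, m))
    (N : 'M[R[i]]_(l, m)) (Y : 'M[R[i]]_(m, n)) :
  L^t* *m L + N^t* *m N = 1%:M ->
  sqnorm Y = sqnorm (L *m Y) + sqnorm (N *m Y).
Proof.
move=> LN1; apply: complexI; rewrite rmorphD /= !sqnormE !trmxC_mul.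
rewrite !mulmxA [X in _ = X + _]mxtrace_mulC [X in _ = _ + X]mxtrace_mulC.
by rewrite !mulmxA -mxtraceD -!mulmxDl LN1 mul1mx.
Qed.

Lemma sqnorm_split_col (R : realType) m n k l (L : 'M[R[i]]_(n, k))
    (N : 'M[R[i]]_(n, l)) (Y : 'M[R[i]]_(m, n)) :
  L *m L^t* + N *m N^t* = 1%:M ->
  sqnorm Y = sqnorm (Y *m L) + sqnorm (Y *m N).
Proof.
move=> LN1; rewrite -[sqnorm Y]sqnorm_trmxC.
rewrite (@sqnorm_split_row _ _ _ _ _ (L^t*) (N^t*)) ?trmxCK //.
by rewrite -!trmxC_mul !sqnorm_trmxC.
Qed.

Lemma mxtrace_trmxC (R : realType) n (A : 'M[R[i]]_n) :
  \tr (A^t*) = Num.conj (\tr A).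
Proof. by rewrite trace_map_mx mxtrace_tr. Qed.

Lemma sqnormD_orthogonal (R : realType) m n (A B : 'M[R[i]]_(m, n)) :
  \tr (A *m B^t*) + Num.conj (\tr (A *m B^t*)) = 0 ->
  sqnorm (A + B) = sqnorm A + sqnorm B.
Proof.
move=> AB0; apply: complexI; rewrite rmorphD /= !sqnormE trmxCD.
have BA : \tr (B *m A^t*) = Num.conj (\tr (A *m B^t*)).
  by rewrite -mxtrace_trmxC trmxC_mul trmxCK.
rewrite mulmxDl !mulmxDr !mxtraceD BA -[RHS]addr0 -AB0 [RHS]addrACA.
by congr (_ + _); rewrite addrC.
Qed.

(** The adjoint preserves the real inner product, while [E] and [G] lie in its eigenspaces for
    opposite signs. *)
Lemma mxtrace_adj_orthogonal (R : realType) S n (E G : 'M[R[i]]_n) :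
  sadj S E = sgn R S *: E -> sadj S G = - (sgn R S *: G) ->
  \tr (E *m G^t*) + Num.conj (\tr (E *m G^t*)) = 0.
Proof.
move=> hE hG.
have trE : \tr (E *m G^t*) = - \tr (sadj S (G^t* *m E)).
  rewrite sadjM sadjC hE hG trmxCN mulmxN linearN opprK.
  case: S {hE hG}; rewrite /= ?scale1r // !scaleN1r trmxCN.
  by rewrite mulmxN mulNmx opprK.
(* In the Hermitian case the trace is minus its own conjugate, so only the real part vanishes; for
   the two transposes it is its own opposite, hence zero. *)
case: S trE {hE hG} => /=; rewrite ?mxtrace_trmxC ?mxtrace_tr mxtrace_mulC;
  try by move=> {1}->; rewrite addNr.
all: move/eqP; rewrite -addr_eq0 -mulr2n mulrn_eq0 => /eqP->.
all: by rewrite rmorph0 addr0.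
Qed.

(** * The diagonal factor and the core block *)

Definition sdiag (R : realType) r (s : 'I_r -> R) : 'M[R[i]]_r :=
  diag_mx (\row_k (s k)%:C).

Lemma conj_real (R : realType) (x : R) : Num.conj x%:C = x%:C.
Proof. by apply/CrealP; rewrite complex_real. Qed.

Lemma trmxC_sdiag (R : realType) r (s : 'I_r -> R) : (sdiag s)^t* = sdiag s.
Proof.
rewrite tr_diag_mx map_diag_mx; congr diag_mx.
by apply/rowP=> k; rewrite !mxE; apply: conj_real.
Qed.

Lemma sadj_sdiag (R : realType) S r (s : 'I_r -> R) : sadj S (sdiag s) = sdiag s.
Proof. by case: S => /=; rewrite ?trmxC_sdiag ?tr_diag_mx. Qed.

Lemma sdiag_unit (R : realType) r (s : 'I_r -> R) :
  (forall k, 0 < s k) -> sdiag s \in unitmx.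
Proof.
move=> s_gt0; rewrite unitmxE det_diag unitfE; apply/prodf_neq0 => k _.
by rewrite mxE fmorph_eq0 gt_eqF.
Qed.

Lemma over_sdiag (R : realType) K r (s : 'I_r -> R) : over_field K (sdiag s).
Proof. by move=> _; rewrite -{2}trmxC_sdiag tr_diag_mx. Qed.

(** This is the block [C] of the overview; the factor [sgn R S] merges [coreT_plus], [coreT_minus]
    and [coreH_plus] into one formula. *)
Definition core_mx (R : realType) S n p r (s : 'I_r -> R) (U1 : 'M[R[i]]_(n, r))
    (V1 : 'M[R[i]]_(p, r)) (B : 'M[R[i]]_(n, p)) : 'M[R[i]]_r :=
  let M := sadj S U1 *m B *m V1 in
  hadamard (Dmx s) (M *m sdiag s + sgn R S *: (sdiag s *m sadj S M)).

(** [Dmx s] is real and symmetric, so the Hadamard product with it commutes with the adjoint, and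
    its other factor has the symmetry of the class. *)
Lemma sadj_core_mx (R : realType) S n p r (s : 'I_r -> R) (U1 : 'M[R[i]]_(n, r))
    (V1 : 'M[R[i]]_(p, r)) (B : 'M[R[i]]_(n, p)) :
  sadj S (core_mx S s U1 V1 B) = sgn R S *: core_mx S s U1 V1 B.
Proof.
have adjH (G : 'M[R[i]]_r) :
    sadj S (hadamard (Dmx s) G) = hadamard (Dmx s) (sadj S G).
  apply/matrixP=> i j; case: S => /=;
    by rewrite !mxE ?rmorphM /= ?conj_real [s j ^+ 2 + _]addrC.
have HZ (a : R[i]) (G : 'M[R[i]]_r) :
    hadamard (Dmx s) (a *: G) = a *: hadamard (Dmx s) G.
  by apply/matrixP=> i j; rewrite !mxE mulrCA.
rewrite /core_mx; set M := _ *m V1; rewrite adjH -HZ; congr hadamard.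
rewrite sadjD sadj_sgnZ !sadjM sadjK sadj_sdiag scalerDr scalerA sgn_sqr scale1r.
by rewrite [RHS]addrC !sadjK.
Qed.

(* The normal equation of the minimization of [|C S1 - M|] over the class:
   the residual, multiplied by [S1], is orthogonal to the class. *)
Lemma core_residual_adj (R : realType) S n p r (s : 'I_r -> R)
    (U1 : 'M[R[i]]_(n, r)) (V1 : 'M[R[i]]_(p, r)) (B : 'M[R[i]]_(n, p)) :
  (forall k, 0 < s k) ->
  let N := (core_mx S s U1 V1 B *m sdiag s - sadj S U1 *m B *m V1) *m sdiag s in
  sadj S N = - (sgn R S *: N).
Proof.
move=> s_gt0 N; have hC := sadj_core_mx S s U1 V1 B; rewrite {}/N.
move: hC; rewrite /core_mx; set M := _ *m V1; set G := (_ + _).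
set C := hadamard _ _ => hC.
(* Entrywise, [Dmx s] inverts the operator taking [C] to [C S1^2 + S1^2 C], whose eigenvalues are
   the sums [s i ^+ 2 + s j ^+ 2]. *)
have CG : C *m sdiag s *m sdiag s + sdiag s *m (sdiag s *m C) = G.
  apply/matrixP=> i j; rewrite !mul_mx_diag !mul_diag_mx !mxE.
  have s2 : (s i ^+ 2 + s j ^+ 2) != 0.
    by rewrite gt_eqF // addr_gt0 ?exprn_gt0.
  have -> (a b d x : R[i]) :
    d * x * b * b + a * (a * (d * x)) = d * (a ^+ 2 + b ^+ 2) * x by ring.
  by rewrite -!rmorphXn -rmorphD -rmorphM /= mul1r mulVf ?mul1r.
move/(congr1 (fun Y => sgn R S *: Y)): CG.
rewrite /G !scalerDr scalerA sgn_sqr scale1r => CG.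
rewrite sadjM sadjD sadjN sadjM sadj_sdiag hC mulmxBl scalerBr mulmxBr.
rewrite -!scalemxAr; apply/eqP; rewrite -subr_eq0 opprK addrC addrACA CG.
by rewrite -opprD subrr.
Qed.

(** * Orthogonal splitting of the residual *)

Lemma sqnorm_residual (R : realType) S n p q r (s : 'I_r -> R)
    (U1 : 'M[R[i]]_(n, r)) (V1 : 'M[R[i]]_(p, r)) (V2 : 'M[R[i]]_(p, q))
    (B : 'M[R[i]]_(n, p)) (A : 'M[R[i]]_n) :
  (forall k, 0 < s k) ->
  U1^t* *m U1 = 1%:M -> V1^t* *m V1 = 1%:M -> V1^t* *m V2 = 0 ->
  V1 *m V1^t* + V2 *m V2^t* = 1%:M -> sadj S A = sgn R S *: A ->
  let S1 := sdiag s in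
  let P := 1%:M - U1 *m U1^t* in
  let C := core_mx S s U1 V1 B in
  sqnorm (A *m (U1 *m S1 *m V1^t*) - B) =
    sqnorm (C *m S1 - sadj S U1 *m B *m V1) + sqnorm (B *m V2)
    + (sqnorm ((sadj S U1 *m A *m U1 - C) *m S1)
       + sqnorm (sadj S P *m (A *m U1 *m S1 - B *m V1))).
Proof.
move=> s_gt0 UU VV VV2 VVT hA S1 P C.
have CR := core_residual_adj S U1 V1 B s_gt0; have hC := sadj_core_mx S s U1 V1 B.
(* The columns split along [V1] and [V2]; as [V1^t* *m V2] vanishes, the second part is just
   [- (B *m V2)]. *)
rewrite (sqnorm_split_col _ VVT) !mulmxBl -!mulmxA VV VV2 !mulmx0 sub0r sqnormN.
rewrite mulmx1 [RHS]addrAC; congr (_ + _).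
(* [P] is a Hermitian idempotent complementary to [U1 *m U1^t*], so [sadj S U1] stacked on
   [sadj S P] is an isometry. *)
rewrite (@sqnorm_split_row _ _ _ _ _ (sadj S U1) (sadj S P)); last first.
  have PC : P^t* = P.
    by rewrite trmxCD trmxCN trmxC_mul trmxCK trmx1 map_mx1.
  have PP : P *m P = P.
    by rewrite mulmxBr mulmxBl mul1mx mulmx1 mulmxBl mul1mx !mulmxA
      -[U1 *m _ *m U1]mulmxA UU mulmx1 subrr subr0.
  by rewrite -!sadjC -!sadjM PC PP -sadjD addrC subrK sadj1.
rewrite !mulmxA addrA; congr (_ + _).
have -> : sadj S U1 *m (A *m U1 *m S1 - B *m V1) =
    (sadj S U1 *m A *m U1 - C) *m S1 + (C *m S1 - sadj S U1 *m B *m V1).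
  by rewrite mulmxBr mulmxBl !mulmxA subrKA.
rewrite -[in RHS]mulmxBl [RHS]addrC; apply: sqnormD_orthogonal.
(* The self-adjoint factor [S1] moves onto the residual, which then has the opposite symmetry by
   [core_residual_adj]. *)
have S1C (R1 : 'M[R[i]]_r) : S1 *m R1^t* = (R1 *m S1)^t*.
  by rewrite trmxC_mul trmxC_sdiag.
rewrite -!(mulmxA _ S1) S1C.
apply: mxtrace_adj_orthogonal CR.
by rewrite sadjD sadjN !sadjM sadjK hA hC scalerBr !mulmxA -scalemxAr -scalemxAl.
Qed.

Definition particular (R : realType) S n p r (s : 'I_r -> R)
    (U1 : 'M[R[i]]_(n, r)) (V1 : 'M[R[i]]_(p, r)) (X B : 'M[R[i]]_(n, p)) :
    'M[R[i]]_n :=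
  let P := 1%:M - X *m mpinv X in
  sadj S (U1^t*) *m core_mx S s U1 V1 B *m U1^t*
    + sgn R S *: (sadj S (B *m mpinv X) *m P) + sadj S P *m B *m mpinv X.

(** * The Moore-Penrose inverse and its value on a thin decomposition *)

Lemma mpinv_unique (R : realType) m n (Y : 'M[R[i]]_(m, n))
    (W W' : 'M[R[i]]_(n, m)) : is_mpinv Y W -> is_mpinv Y W' -> W = W'.
Proof.
move=> [YWY WYW hYW hWY] [YWY' WYW' hYW' hWY'].
(* Two Hermitian projections with the same range: each absorbs the other, and taking adjoints swaps
   the order of their product. *)
have eYW : Y *m W = Y *m W'.
  have <- : Y *m W' *m (Y *m W) = Y *m W by rewrite mulmxA YWY'.
  by rewrite -{1}hYW' -{1}hYW -trmxC_mul mulmxA YWY.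
have eWY : W *m Y = W' *m Y.
  have <- : W *m Y *m (W' *m Y) = W *m Y by rewrite -mulmxA (mulmxA Y) YWY'.
  by rewrite -{1}hWY -{1}hWY' -trmxC_mul -mulmxA (mulmxA Y) YWY.
by rewrite -WYW eWY -mulmxA eYW mulmxA WYW'.
Qed.

Lemma mpinvE (R : realType) m n (Y : 'M[R[i]]_(m, n)) (W : 'M[R[i]]_(n, m)) :
  is_mpinv Y W -> mpinv Y = W.
Proof.
move=> hW; apply: (mpinv_unique _ hW).
apply: (@xgetPex _ 0 [set W | is_mpinv Y W]%classic).
by exists W.
Qed.

Lemma mpinv_svd (R : realType) n p r (s : 'I_r -> R) (U1 : 'M[R[i]]_(n, r))
    (V1 : 'M[R[i]]_(p, r)) :
  (forall k, 0 < s k) -> U1^t* *m U1 = 1%:M -> V1^t* *m V1 = 1%:M ->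
  mpinv (U1 *m sdiag s *m V1^t*) = V1 *m invmx (sdiag s) *m U1^t*.
Proof.
move=> s_gt0 UU VV; have s_unit := sdiag_unit s_gt0; apply: mpinvE.
have XW : U1 *m sdiag s *m V1^t* *m (V1 *m invmx (sdiag s) *m U1^t*) = U1 *m U1^t*.
  by rewrite !mulmxA -(mulmxA _ _ V1) VV mulmx1 -(mulmxA U1) mulmxV ?mulmx1.
have WX : V1 *m invmx (sdiag s) *m U1^t* *m (U1 *m sdiag s *m V1^t*) = V1 *m V1^t*.
  by rewrite !mulmxA -(mulmxA _ _ U1) UU mulmx1 -(mulmxA V1) mulVmx ?mulmx1.
split.
- by rewrite XW !mulmxA -(mulmxA U1) UU mulmx1.
- by rewrite WX !mulmxA -(mulmxA V1) VV mulmx1.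
- by rewrite XW trmxC_mul trmxCK.
- by rewrite WX trmxC_mul trmxCK.
Qed.

(** * The shape of the minimizers *)

Lemma over_hadamard_Dmx (R : realType) K r (s : 'I_r -> R) (G : 'M[R[i]]_r) :
  over_field K G -> over_field K (hadamard (Dmx s) G).
Proof.
move=> hG hK; apply/matrixP=> i j; rewrite -{2}(hG hK) !mxE rmorphM /=.
by rewrite conj_real.
Qed.

Lemma over_core_mx (R : realType) K S n p r (s : 'I_r -> R)
    (U1 : 'M[R[i]]_(n, r)) (V1 : 'M[R[i]]_(p, r)) (B : 'M[R[i]]_(n, p)) :
  over_field K U1 -> over_field K V1 -> over_field K B ->
  over_field K (core_mx S s U1 V1 B).
Proof.
move=> hU hV hB; have hM : over_field K (sadj S U1 *m B *m V1).
  by do 2 ![apply: overM => //]; apply: over_sadj.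
apply: over_hadamard_Dmx; apply: overD; first exact/overM/over_sdiag.
by apply/over_sgnZ/overM; [apply: over_sdiag | apply: over_sadj].
Qed.

(* The residual of [A] exceeds the minimum by the two squares below, so this
   lemma describes the minimizers. *)
Lemma minimizer_form (R : realType) K S n p r (s : 'I_r -> R)
    (U1 : 'M[R[i]]_(n, r)) (V1 : 'M[R[i]]_(p, r)) (B : 'M[R[i]]_(n, p))
    (A : 'M[R[i]]_n) :
  (forall k, 0 < s k) -> U1^t* *m U1 = 1%:M -> V1^t* *m V1 = 1%:M ->
  over_field (class_field S K) U1 -> over_field (class_field S K) V1 ->
  over_field (class_field S K) B ->
  let S1 := sdiag s in
  let X := U1 *m S1 *m V1^t* in
  let P := 1%:M - U1 *m U1^t* in
  (in_class K S A /\
    [/\ (sadj S U1 *m A *m U1 - core_mx S s U1 V1 B) *m S1 = 0 &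
        sadj S P *m (A *m U1 *m S1 - B *m V1) = 0]) <->
  exists2 Z, in_class K S Z &
    A = particular S s U1 V1 X B
        + sadj S (1%:M - X *m mpinv X) *m Z *m (1%:M - X *m mpinv X).
Proof.
move=> s_gt0 UU VV hU hV hB S1 X P; have s_unit := sdiag_unit s_gt0.
have hC := sadj_core_mx S s U1 V1 B.
have oC : over_field (class_field S K) (core_mx S s U1 V1 B) by apply: over_core_mx.
rewrite /particular mpinv_svd //; set C := core_mx S s U1 V1 B in hC oC *.
set W := V1 *m invmx (sdiag s) *m U1^t*.
have -> : X *m W = U1 *m U1^t*.
  by rewrite /X /W !mulmxA -(mulmxA _ _ V1) VV mulmx1 -(mulmxA U1) mulmxV ?mulmx1.
rewrite -/P.
have oP : over_field (class_field S K) P.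
  by apply: overD; [exact: over1 | apply: overN; apply: overM => //; apply: over_trmxC].
have oW : over_field (class_field S K) W.
  apply: overM; last exact: over_trmxC.
  by apply: overM => // hK; rewrite map_invmx (over_sdiag s hK).
have PU : P *m U1 = 0 by rewrite mulmxBl mul1mx -mulmxA UU mulmx1 subrr.
have UP : U1^t* *m P = 0 by rewrite mulmxBr mulmx1 mulmxA UU mul1mx subrr.
have PP : P *m P = P by rewrite {2}/P mulmxBr mulmx1 mulmxA PU mul0mx subr0.
have WU : W *m U1 *m S1 = V1.
  by rewrite /W -(mulmxA _ _ U1) UU mulmx1 -mulmxA mulVmx ?mulmx1.
have Q1 : U1 *m U1^t* + P = 1%:M by rewrite addrC subrK.
have eW : W = V1 *m invmx (sdiag s) *m U1^t* by [].
clearbody P W.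
split=> [[/in_classP[oA hA] [A11 A21]] | [Z /in_classP[oZ hZ] ->]].
(* [A] itself serves as [Z], since the factors [P] on both sides keep only its free block. *)
- exists A; first exact/in_classP.
  have {}A11 : sadj S U1 *m A *m U1 = C.
    apply/eqP; rewrite -subr_eq0; apply/eqP.
    by rewrite -[LHS](mulmxK s_unit) A11 mul0mx.
  have {}A21 : sadj S P *m A *m (U1 *m U1^t*) = sadj S P *m B *m W.
    move/eqP: A21; rewrite mulmxBr subr_eq0 !mulmxA => /eqP A21.
    by rewrite -[in LHS](mulmxK s_unit (_ *m U1)) A21 eW !mulmxA.
  (* The upper right block is the adjoint of the lower left one, up to the sign of the class. *)
  have A12 (Q Y : 'M_n) : sadj S P *m A *m Q = sadj S P *m Y ->
      sadj S Q *m A *m P = sgn R S *: (sadj S Y *m P).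
    move/(congr1 (@sadj R S n n)); rewrite !sadjM sadjK hA -scalemxAl -scalemxAr.
    by move<-; rewrite scalerA sgn_sqr scale1r mulmxA.
  (* Inserting the resolution of the identity on both sides cuts [A] into its four blocks. *)
  have AQ : A = sadj S (U1 *m U1^t* + P) *m A *m (U1 *m U1^t* + P).
    by rewrite Q1 sadj1 mul1mx mulmx1.
  rewrite {1}AQ.
  rewrite -(A12 (U1 *m U1^t*)); last first.
    by rewrite A21 -mulmxA.
  rewrite sadjD !mulmxDl !mulmxDr A21 addrA.
  congr (_ + _ + _ + _).
  by rewrite sadjM !mulmxA -A11 !mulmxA.
- set A' := (_ + _); split.
    apply/in_classP; split.
      apply: overD; last first.
        by apply: overM => //; apply: overM => //; apply: over_sadj.
      apply: overD; last first.
        by apply: overM => //; apply: overM => //; apply: over_sadj.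
      apply: overD; last first.
        by apply/over_sgnZ/overM => //; apply/over_sadj/overM.
      apply: overM; last exact: over_trmxC.
      by apply: overM => //; apply/over_sadj/over_trmxC.
    (* Up to sign, the adjoint fixes the core and [Z] terms and exchanges the two off-diagonal
       ones. *)
    rewrite /A' !sadjD sadj_sgnZ !sadjM !sadjK hC hZ !scalerDr scalerA sgn_sqr scale1r.
    by rewrite -!scalemxAl -!scalemxAr !mulmxA; congr (_ + _); rewrite addrAC.
  (* [P *m U1] vanishes, so only the terms ending in [U1^t*] or [W] survive. *)
  have AU : A' *m U1 = sadj S (U1^t*) *m C + sadj S P *m B *m W *m U1.
    rewrite /A' !mulmxDl -scalemxAl -(mulmxA _ P U1) -(mulmxA _ (U1^t*) U1).
    by rewrite -(mulmxA _ P U1) PU UU !mulmx0 scaler0 !addr0 mulmx1.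
  split.
    rewrite -(mulmxA (sadj S U1)) AU mulmxDr !mulmxA -!sadjM UU PU sadj1 mul1mx.
    by rewrite sadj0 !mul0mx addr0 subrr mul0mx.
  rewrite AU mulmxDl mulmxBr mulmxDr !mulmxA -[sadj S P *m sadj S (U1^t*)]sadjM UP.
  rewrite -[sadj S P *m sadj S P]sadjM PP -(mulmxA _ W) -(mulmxA _ (W *m U1)) WU.
  by rewrite sadj0 !mul0mx add0r subrr.
Qed.

(** * The distance as an attained minimum *)

Lemma rho_min (R : realType) K S n p (X B : 'M[R[i]]_(n, p)) (Ao : 'M_n) :
  in_class K S Ao ->
  (forall A, in_class K S A -> sqnorm (Ao *m X - B) <= sqnorm (A *m X - B)) ->
  rho K S X B = frobenius (Ao *m X - B).
Proof.
move=> Ao_S Ao_min; apply/eqP; rewrite eq_le; apply/andP; split.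
  apply: ge_inf; last by exists Ao.
  (* Norms are nonnegative, so the set is bounded below. *)
  by exists 0 => _ [A _ <-]; apply: sqrtr_ge0.
apply: lb_le_inf; first by exists (frobenius (Ao *m X - B)), Ao.
by move=> _ [A A_S <-]; rewrite ler_wsqrtr ?Ao_min.
Qed.

Lemma rho_thin_svd (R : realType) K S n p q r (s : 'I_r -> R)
    (U1 : 'M[R[i]]_(n, r)) (V1 : 'M[R[i]]_(p, r)) (V2 : 'M[R[i]]_(p, q))
    (X B : 'M[R[i]]_(n, p)) :
  (forall k, 0 < s k) ->
  U1^t* *m U1 = 1%:M -> V1^t* *m V1 = 1%:M -> V1^t* *m V2 = 0 ->
  V1 *m V1^t* + V2 *m V2^t* = 1%:M ->
  over_field K U1 -> over_field K V1 -> over_field K B ->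
  X = U1 *m sdiag s *m V1^t* ->
  rho K S X B =
    Num.sqrt (frobenius (core_mx S s U1 V1 B *m sdiag s
                         - sadj S U1 *m B *m V1) ^+ 2
              + frobenius (B *m V2) ^+ 2) /\
  forall Ao : 'M[R[i]]_n,
    (in_class K S Ao /\ frobenius (Ao *m X - B) = rho K S X B) <->
    exists2 Z, in_class K S Z &
      Ao = particular S s U1 V1 X B
           + sadj S (1%:M - X *m mpinv X) *m Z *m (1%:M - X *m mpinv X).
Proof.
move=> s_gt0 UU VV VV2 VVT /(@over_class_field R K S _ _ _) hU /(@over_class_field R K S _ _ _) hV.
move=> /(@over_class_field R K S _ _ _) hB ->.
have form A := minimizer_form A s_gt0 UU VV hU hV hB.
rewrite !sqr_frobenius; set m := sqnorm _ + sqnorm _.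
have resid A (A_S : in_class K S A) :
    sqnorm (A *m (U1 *m sdiag s *m V1^t*) - B) =
    m + (sqnorm ((sadj S U1 *m A *m U1 - core_mx S s U1 V1 B) *m sdiag s)
         + sqnorm (sadj S (1%:M - U1 *m U1^t*)
                   *m (A *m U1 *m sdiag s - B *m V1))).
  by apply: sqnorm_residual => //; case/in_classP: A_S.
have m_ge0 : 0 <= m by rewrite addr_ge0 ?sqnorm_ge0.
clearbody m.
have sqnorm0 k l : sqnorm (0 : 'M[R[i]]_(k, l)) = 0.
  by apply: complexI; rewrite sqnormE mul0mx mxtrace0.
(* A minimizer exists: [minimizer_form] read from right to left at [Z = 0]. *)
have [A0 [A0_S [A011 A021]]] : exists A, in_class K S A /\
    [/\ (sadj S U1 *m A *m U1 - core_mx S s U1 V1 B) *m sdiag s = 0 &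
        sadj S (1%:M - U1 *m U1^t*) *m (A *m U1 *m sdiag s - B *m V1) = 0].
  eexists; apply/form; exists 0; last by [].
  apply/in_classP; split; first by move=> hK; rewrite map_mx0.
  by rewrite sadj0 scaler0.
have rhoE : rho K S (U1 *m sdiag s *m V1^t*) B = Num.sqrt m.
  have A0_m : sqnorm (A0 *m (U1 *m sdiag s *m V1^t*) - B) = m.
    by rewrite (resid _ A0_S) A011 A021 !sqnorm0 !addr0.
  rewrite (rho_min A0_S) ?frobeniusE ?A0_m // => A A_S.
  by rewrite (resid _ A_S) lerDl addr_ge0 ?sqnorm_ge0.
split=> // A; apply: iff_trans (form A); rewrite rhoE frobeniusE.
split=> -[A_S]; last first.
  case=> A11 A21; split=> //.
  by rewrite (resid _ A_S) A11 A21 !sqnorm0 !addr0.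
(* Equality with the minimum leaves a zero sum of two nonnegative terms, so both vanish. *)
move/eqP; rewrite eqr_sqrt ?sqnorm_ge0 // (resid _ A_S) -subr_eq0 addrAC subrr.
rewrite add0r paddr_eq0 ?sqnorm_ge0 // => /andP[/eqP A11 /eqP A21].
by split; [exact: A_S | split; apply: sqnorm_eq0; [exact: A11 | exact: A21]].
Qed.

(** * From the full decomposition to its thin blocks *)

Lemma colsub_gram (R : realType) m n k l (f : 'I_k -> 'I_n) (g : 'I_l -> 'I_n)
    (A : 'M[R[i]]_(m, n)) :
  (colsub f A)^t* *m colsub g A = mxsub f g (A^t* *m A).
Proof.
by apply/matrixP=> i j; rewrite !mxE; apply: eq_bigr => x _; rewrite !mxE.
Qed.

Lemma gram_first_last (R : realType) m n r (hr : (r <= n)%N)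
    (A : 'M[R[i]]_(m, n)) :
  first_cols hr A *m (first_cols hr A)^t* + last_cols hr A *m (last_cols hr A)^t*
  = A *m A^t*.
Proof.
apply/matrixP=> i j; rewrite !mxE (reindex (cast_ord (subnKC hr))) /=; last first.
  by exists (cast_ord (esym (subnKC hr))) => x _; rewrite ?cast_ordK ?cast_ordKV.
rewrite big_split_ord; congr (_ + _); apply: eq_bigr => x _; rewrite !mxE //.
by rewrite (_ : cast_ord _ _ = widen_ord hr x) //; apply: val_inj.
Qed.

Lemma svd_thin (R : realType) n p r (hrn : (r <= n)%N) (hrp : (r <= p)%N)
    (U : 'M[R[i]]_n) (s : 'I_r -> R) (V : 'M[R[i]]_p) :
  U *m (\sum_(k < r) (s k)%:C
          *: delta_mx (widen_ord hrn k) (widen_ord hrp k)) *m V^t*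
  = first_cols hrn U *m sdiag s *m (first_cols hrp V)^t*.
Proof.
rewrite mulmx_sumr mulmx_suml; apply/matrixP=> i j; rewrite summxE mxE.
apply: eq_bigr => k _; rewrite -scalemxAr -scalemxAl mxE.
(* Each [delta_mx] is a unit column times a unit row, which select a column of [U] and a row of
   [V^t*]. *)
rewrite -(mul_delta_mx (ord0 : 'I_1)) mulmxA -colE -mulmxA -rowE.
by rewrite mul_mx_diag !mxE big_ord1 !mxE mulrA [_ * U _ _]mulrC.
Qed.

Lemma leading_block_svd (R : realType) n p r (hrn : (r <= n)%N)
    (hrp : (r <= p)%N) (s : 'I_r -> R) :
  leading_block hrn hrp (\sum_(k < r) (s k)%:C
      *: delta_mx (widen_ord hrn k) (widen_ord hrp k)) = sdiag s.
Proof.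
apply/matrixP=> i j; rewrite !mxE summxE (bigD1 i) //= big1 => [|k ki].
  by rewrite !mxE eqxx addr0 -val_eqE /= val_eqE eq_sym mulr_natr.
by rewrite !mxE -val_eqE /= val_eqE eq_sym (negPf ki) mulr0.
Qed.

Theorem theorem3p2 (R : realType) (K : base_field) (S : mx_class)
    (n p r : nat) (hrn : (r <= n)%N) (hrp : (r <= p)%N)
    (X B : 'M[R[i]]_(n, p)) (U : 'M[R[i]]_n) (s : 'I_r -> R)
    (Sg : 'M[R[i]]_(n, p)) (V : 'M[R[i]]_p)
    (hX : X \is a mxOver (scalars R K)) (hB : B \is a mxOver (scalars R K))
    (hrank : \rank X = r) (hsvd : is_svd K hrn hrp X U s Sg V) :
  let U1 := first_cols hrn U in
  let V1 := first_cols hrp V in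
  let V2 := last_cols hrp V in
  let S1 := leading_block hrn hrp Sg in
  let P := 1%:M - X *m mpinv X in
  rho K S X B =
    match S with
    | Sym =>
        Num.sqrt (frobenius (coreT_plus s U1 S1 V1 B *m S1 - U1^T *m B *m V1) ^+ 2
                  + frobenius (B *m V2) ^+ 2)
    | Herm =>
        Num.sqrt (frobenius (coreH_plus s U1 S1 V1 B *m S1 - U1^t* *m B *m V1) ^+ 2
                  + frobenius (B *m V2) ^+ 2)
    | SkewSym =>
        Num.sqrt (frobenius (coreT_minus s U1 S1 V1 B *m S1 - U1^T *m B *m V1) ^+ 2
                  + frobenius (B *m V2) ^+ 2)
    end
  /\
  forall Ao : 'M[R[i]]_n,
    (in_class K S Ao /\ frobenius (Ao *m X - B) = rho K S X B) <->
    exists2 Z : 'M[R[i]]_n, in_class K S Z &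
      Ao = match S with
           | Sym => FT_plus s U1 S1 V1 X B + P^T *m Z *m P
           | SkewSym => FT_minus s U1 S1 V1 X B + P^T *m Z *m P
           | Herm => FH_plus s U1 S1 V1 X B + P^t* *m Z *m P
           end.
Proof.
case: hsvd => -[/overP oU /unitarymxP UU] [/overP oV /unitarymxP VV] s_gt0 -> ->.
move=> U1 V1 V2 S1 P; move/overP in hB.
have UU1 : U1^t* *m U1 = 1%:M.
  (* The Gram matrix of selected columns is a submatrix of the identity. *)
  rewrite colsub_gram (mulmx1C UU); apply/matrixP=> i j.
  by rewrite !mxE -val_eqE.
have VV1 : V1^t* *m V1 = 1%:M.
  rewrite colsub_gram (mulmx1C VV); apply/matrixP=> i j.
  by rewrite !mxE -val_eqE.
have VV2 : V1^t* *m V2 = 0.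
  rewrite colsub_gram (mulmx1C VV); apply/matrixP=> i j.
  (* The columns of [V2] have indices at least [r], those of [V1] below [r], so only off-diagonal
     entries of the identity occur. *)
  by rewrite !mxE -val_eqE /= ltn_eqF // ltn_addr.
have VVT : V1 *m V1^t* + V2 *m V2^t* = 1%:M by rewrite gram_first_last.
have over_colsub m k l (f : 'I_k -> 'I_l) (A : 'M[R[i]]_(m, l)) :
    over_field K A -> over_field K (colsub f A).
  by move=> oA hK; rewrite map_mxsub oA.
have [rhoE form] := rho_thin_svd S s_gt0 UU1 VV1 VV2 VVT
  (over_colsub _ _ _ _ _ oU) (over_colsub _ _ _ _ _ oV) hB (svd_thin _ _ _ _ _).
have S1E : S1 = sdiag s by apply: leading_block_svd.
have coreE : core_mx S s U1 V1 B = match S with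
    | Sym => coreT_plus s U1 S1 V1 B
    | SkewSym => coreT_minus s U1 S1 V1 B
    | Herm => coreH_plus s U1 S1 V1 B
    end.
  rewrite /core_mx !sadjM sadjK S1E; clear; case: S => /=;
    by rewrite ?scale1r ?scaleN1r !mulmxA.
have partE X' : particular S s U1 V1 X' B = match S with
    | Sym => FT_plus s U1 S1 V1 X' B
    | SkewSym => FT_minus s U1 S1 V1 X' B
    | Herm => FH_plus s U1 S1 V1 X' B
    end.
  have UT : (U1^t*)^T = map_mx Num.conj U1 by rewrite map_trmx trmxK.
  rewrite /particular coreE; case: (S) => /=.
  - by rewrite scale1r UT.
  - by rewrite scaleN1r UT.
  - by rewrite trmxCK scale1r.
split=> [|Ao].
  by rewrite rhoE coreE S1E; clear; case: S.
by rewrite form partE; clear; case: S.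
Qed.
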